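(* Let $0<\lambda\le\Lambda$ and $\rho=\Lambda/\lambda$. (1) If $n\in\mathbb{N}$ satisfies $p_n(\alpha_{n+1})\le\rho<p_n(\alpha_{n+2})$, then $f_n$ is optimal for $\rho$ (i.e. $CR(f_n)\le CR(f_m)$ for every $m\in\mathbb{N}$), and the parameter $a_0$ of $f_n$ satisfies $\alpha_{n+1}\le a_0<\alpha_{n+2}$. (2) For all $n\in\mathbb{N}$, if $p_n(\alpha_{n+1})\le\rho<p_n(\alpha_{n+2})$ then $2^n\le p_n(\alpha_{n+1})\le\rho<p_n(\alpha_{n+2})\le 2^{n+2}$.
   Context: Search on a line: fix reals $0<\lambda\le\Lambda$ and put $\rho=\Lambda/\lambda\ge 1$. A search strategy is a function $f:\mathbb{N}\to\mathbb{R}^+$ ($\mathbb{N}=\{0,1,2,\dots\}$): in iteration $i$ the searcher walks distance $f(i)$ from the origin, alternating directions, and returns to the origin, until it reaches a target at unknown distance $D\in[\lambda,\Lambda]$ on an unknown side. For $D>0$ let $f^{-1}(D)$ be the smallest $j$ with $f(j)\ge D$, let $\phi(f,D)=2\sum_{i=0}^{f^{-1}(D)}f(i)+D$, and $CR(f)=\sup_{D\in[\lambda,\Lambda]}\phi(f,D)/D$. Polynomials: $p_0(x)=x$, $p_1(x)=x(x-1)$, $p_i(x)=x(p_{i-1}(x)-p_{i-2}(x))$ for $i\ge2$; $\alpha_i$ is the largest real root of $p_i$. The strategy $f_n$ ($n\in\mathbb{N}$): set $a_n:=\rho$; $f_n(i)=a_i\lambda$ for $0\le i<n$ and $f_n(i)=\Lambda$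 for $i\ge n$, where for $n\ge1$ the reals $1\le a_0\le\cdots\le a_{n-1}\le\rho$ satisfy $1+2\sum_{k=0}^{i+1}a_k/a_i=2a_0+1$ for $0\le i\le n-2$ and $1+2\sum_{k=0}^{n-1}a_k/a_{n-1}+2\rho/a_{n-1}=2a_0+1$ (equal worst-case ratio on every subinterval); for $n=0$, $f_0\equiv\Lambda$ and $a_0=\rho$. We say $f_n$ is optimal for $\rho$ if $CR(f_n)\le CR(f_m)$ for all $m\in\mathbb{N}$ (an optimal search strategy may be taken to be periodic and monotone, hence of this form). *)

(* Defs.v *)
From HB Require Import structures.
From mathcomp Require Import all_boot all_order all_algebra.
From mathcomp Require Import all_classical all_reals all_analysis.

Set Implicit Arguments.
Unset Strict Implicit.
Unset Printing Implicit Defensive.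

Import Order.TTheory GRing.Theory Num.Theory.

Local Open Scope classical_set_scope.
Local Open Scope ring_scope.

Section SearchCost.
Context {R : realType}.
Implicit Types (f : nat -> R) (D lam Lam : R).

(* [ex_minn] is the first round [j] with [D <= f j]; a target that no round
   reaches costs [+oo]. *)
Definition phi f D : \bar R :=
  if pselect (exists j, D <= f j) is left reached
  then (2 * (\sum_(i < (ex_minn reached).+1) f i) + D)%:E
  else +oo%E.

Definition CR lam Lam f : \bar R :=
  ereal_sup [set (phi f D * (D^-1)%:E)%E | D in `[lam, Lam]].

End SearchCost.

Section Polynomials.
Context (R : realType).

Fixpoint p (i : nat) : {poly R} :=
  match i with
  | 0 => 'X
  | 1 => 'X * ('X - 1)
  | (j.+1 as k).+1 => 'X * (p k - p j)
  end.

Definition largest_root (q : {poly R}) (x : R) : Prop :=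
  root q x /\ forall y, root q y -> y <= x.

(* The default value 0 of [xget] is never used: see [alphaP]. *)
Definition alpha (i : nat) : R := xget 0 [set x | largest_root (p i) x].

Lemma largest_root_exists (q : {poly R}) (x : R) :
  q != 0 -> root q x -> exists y, largest_root q y.
Proof.
have [n] := ubnP (size q); elim: n q x => // n IH q x sq q0 /[dup] qx.
move=> /factor_theorem[r qE].
have r0 : r != 0 by apply: contraNneq q0 => r0; rewrite qE r0 mul0r.
have sr : (size r < n)%N.
  by move: sq; rewrite qE size_Mmonic ?monicXsubC// size_XsubC addn2.
have rootE y : root q y = root r y || (y == x).
  by rewrite qE rootM root_XsubC.
have [[z rz]|nr] := pselect (exists z, root r z); last first.
  exists x; split=> // y; rewrite rootE => /orP[ry|/eqP->//].
  by case: nr; exists y.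
have [y [ry ymax]] := IH r z sr r0 rz.
exists (Num.max x y); split.
  by rewrite rootE; case: leP; rewrite ?ry ?eqxx ?orbT.
move=> t; rewrite rootE le_max => /orP[/ymax ->|/eqP->]; last by rewrite lexx.
by rewrite orbT.
Qed.

Lemma p_monic_size i : p i \is monic /\ size (p i) = i.+2.
Proof.
have [//] : (p i \is monic /\ size (p i) = i.+2) /\
            (p i.+1 \is monic /\ size (p i.+1) = i.+3).
elim: i => [|i [[mi si] [mi1 si1]]].
  rewrite /= monicX size_polyX; split=> //.
  have m1 : ('X - 1 : {poly R}) \is monic by rewrite -polyC1 monicXsubC.
  by rewrite monicMl ?monicX// size_monicM ?monicX ?monic_neq0// size_polyX
             -polyC1 size_XsubC.
split=> //; rewrite -[p i.+2]/('X * (p i.+1 - p i)).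
have lt : (size (- p i) < size (p i.+1))%N by rewrite size_polyN si si1.
have m1 : p i.+1 - p i \is monic by rewrite monicE lead_coefDl// -monicE.
by rewrite monicMl ?monicX// size_monicM ?monicX ?monic_neq0// size_polyX
           size_polyDl// si1.
Qed.

Lemma alphaP i : largest_root (p i) (alpha i).
Proof.
have [mp _] := p_monic_size i.
have p0 : root (p i) 0.
  by case: i {mp} => [|[|i]]; rewrite /root /= ?hornerM hornerX ?mul0r.
have [y Hy] := largest_root_exists (monic_neq0 mp) p0.
by rewrite /alpha; case: xgetP => // /(_ y).
Qed.

End Polynomials.

Arguments p : clear implicits.
Arguments alpha : clear implicits.

Section Strategies.
Context {R : realType}.
Implicit Types (a : nat -> R) (rho lam Lam : R).

(* The conditions on the reals [a 0, ..., a n] defining the [n]-th strategy;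
   [a i] is unconstrained and unused for [i > n]. The chain
   [a 0 <= ... <= a n.-1 <= rho] is the third clause, since [a n = rho].
   No such reals exist when [n] is too large for [rho]. *)
Definition params rho (n : nat) a : Prop :=
  [/\ a n = rho,
      (0 < n)%N -> 1 <= a 0%N,
      forall i, (i < n)%N -> a i <= a i.+1,
      forall i, (i.+2 <= n)%N ->
        1 + 2 * (\sum_(k < i.+2) a k / a i) = 2 * a 0%N + 1
    & (0 < n)%N ->
        1 + 2 * (\sum_(k < n) a k / a n.-1) + 2 * rho / a n.-1
          = 2 * a 0%N + 1].

Definition strategy lam Lam (n : nat) a : nat -> R :=
  fun i => if (i < n)%N then a i * lam else Lam.

Definition optimal lam Lam (n : nat) a : Prop :=
  forall (m : nat) (b : nat -> R), params (Lam / lam) m b ->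
    (CR lam Lam (strategy lam Lam n a) <= CR lam Lam (strategy lam Lam m b))%E.

End Strategies.

(* Main.v *)
Require Import Defs.
From HB Require Import structures.
From mathcomp Require Import all_boot all_order all_algebra.
From mathcomp Require Import all_classical all_reals all_analysis.
From mathcomp Require Import ring lra zify.
Import Order.TTheory GRing.Theory Num.Theory.
Local Open Scope ring_scope.

(** The equations defining [f_n] say that [a_i = p_i(a_0)] and
    [p_n(a_0) = rho], and then every worst-case ratio, hence [CR(f_n)], equals
    [2 a_0 + 1]; the optimal [f_n] is the one with the least [a_0]. The ratios
    [p_(k+1) / p_k] increase as long as they stay nonnegative, so [p_k] increases
    beyond [alpha_k], and [alpha_k <= x] as soon as [p_0, ..., p_k] are
    nonnegative at [x > 0]. This gives existence and [alpha_(n+1) <= a_0], and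
    it compares the values of [a_0] for different [n]. Cassini's identity
    [p_(k+1)^2 - p_(k+2) p_k = x^(k+2)] yields
    [p_n(alpha_(n+1))^2 = alpha_(n+1)^(n+1)] and
    [p_n(alpha_(n+2))^2 = alpha_(n+2)^(n+2)], and the bounds by powers of two
    follow from [4^n <= alpha_(n+1)^(n+1)] and [alpha_(n+2) <= 4]. *)

Import numFieldNormedType.Exports.

Section SearchPolynomials.
Set Implicit Arguments.
Unset Strict Implicit.
Unset Printing Implicit Defensive.
Context {R : realType}.
Implicit Types (x y rho : R) (a b : nat -> R) (i j k m n : nat).

Local Notation P k x := (p R k).[x].
Local Notation alpha := (alpha R).

(** * Recurrence and monotonicity of the polynomials *)

Lemma horner_p0 x : P 0 x = x.
Proof. by rewrite /= hornerX. Qed.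

Lemma horner_p1 x : P 1 x = x * (x - 1).
Proof. by rewrite /= !hornerE. Qed.

Lemma horner_pSS k x : P k.+2 x = x * (P k.+1 x - P k x).
Proof. by rewrite -[p R k.+2]/('X * (p R k.+1 - p R k)) !hornerE. Qed.

Local Arguments p : simpl never.

(** For [0 < x] this is equivalent to [alpha k <= x]; in this form monotonicity can be proved before
    the roots are studied. *)
Definition p_nonneg k x := forall j, (j <= k)%N -> 0 <= P j x.

Lemma p_nonnegS k x : p_nonneg k.+1 x -> p_nonneg k x.
Proof. by move=> nn j jk; apply: nn; rewrite (leq_trans jk). Qed.

(* The ratios [p k.+1 / p k] increase with [x]; the products keep them free of
   division. *)
Lemma p_ratio_lt k x y : 0 < x -> x < y -> p_nonneg k.+1 x ->
  [/\ 0 < P k x, 0 < P k y, 0 < P k.+1 y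
    & P k.+1 x * P k y < P k.+1 y * P k x].
Proof.
move=> x0 xy; elim: k => [|k IH] nn.
  have := nn 1%N isT; rewrite horner_p1 pmulr_rge0// subr_ge0 => x1.
  rewrite !horner_p1 !horner_p0; split; [lra|lra|nra|].
  have : 0 < x * y * (y - x) by rewrite !mulr_gt0//; lra.
  nra.
have [A0 A'0 B'0 lt] := IH (p_nonnegS nn).
have := nn k.+2 (leqnn _); rewrite !horner_pSS pmulr_rge0// subr_ge0.
move: (P k x) (P k.+1 x) (P k y) (P k.+1 y) A0 A'0 B'0 lt => A B A' B'.
move=> A0 A'0 B'0 lt AB.
have B0 : 0 < B by lra.
(* The ratio [r = B / A] is followed by [x * (1 - 1 / r)], which increases with both [x] and [r]. *)
have BB : (B - A) * B' < (B' - A') * B by lra.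
have BB0 : 0 <= (B - A) * B' by rewrite mulr_ge0//; lra.
have d0 : 0 < B' - A' by rewrite -(pmulr_lgt0 _ B0); lra.
split=> //; first by rewrite mulr_gt0//; lra.
rewrite -!mulrA; apply: (@le_lt_trans _ _ (y * ((B - A) * B'))).
  by rewrite ler_wpM2r// ltW.
by rewrite ltr_pM2l//; lra.
Qed.

Lemma p_lt k x y : 0 < x -> x < y -> p_nonneg k x -> P k x < P k y.
Proof.
move=> x0 xy; elim: k => [|k IH] nn; first by rewrite !horner_p0.
have [A0 A'0 B'0 lt] := p_ratio_lt x0 xy nn.
have AA := IH (p_nonnegS nn).
rewrite -(ltr_pM2r A'0) (lt_trans lt)//.
by rewrite ltr_pM2l.
Qed.

(** At [x = 4] the recurrence has the double characteristic root 2, whence the linear factor.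
    Positivity here is what will bound all roots by 4. *)
Lemma horner_p_4 k : P k 4 = 2 ^+ k.+1 * (k.+2)%:R.
Proof.
suff [] : P k 4 = 2 ^+ k.+1 * (k.+2)%:R /\
  P k.+1 4 = 2 ^+ k.+2 * (k.+3)%:R by [].
elim: k => [|k [IH IH1]].
  by rewrite horner_p0 horner_p1; split; ring.
by split=> //; rewrite horner_pSS IH IH1 !exprS -!natr1; ring.
Qed.

Lemma p_gt0_4 k : 0 < P k 4.
Proof. by rewrite horner_p_4 mulr_gt0// exprn_gt0. Qed.

Lemma p_nonneg_4 k : p_nonneg k 4.
Proof. by move=> j _; exact/ltW/p_gt0_4. Qed.

Lemma p_gt0_ge4 k x : 4 <= x -> 0 < P k x.
Proof.
rewrite le_eqVlt => /orP[/eqP<-|x4]; first exact: p_gt0_4.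
by apply: (lt_trans (p_gt0_4 k)); apply: p_lt => //; exact: p_nonneg_4.
Qed.

(** * Order and size of the largest roots *)

Lemma horner_p_alpha k : P k (alpha k) = 0.
Proof. by have [/rootP] := alphaP R k. Qed.

Lemma alpha_max k x : P k x = 0 -> x <= alpha k.
Proof. by move=> /rootP; have [_] := alphaP R k; apply. Qed.

(** Otherwise positivity at 4 would force a root in [[x, 4]], beyond the largest one. *)
Lemma p_gt0_gt_alpha k x : alpha k < x -> 0 < P k x.
Proof.
move=> ax; rewrite ltNge; apply/negP => Px.
have x4 : x <= 4.
  by rewrite leNgt; apply/negP => /ltW/(@p_gt0_ge4 k); rewrite ltNge Px.
have [|z /andP[xz _] /rootP/alpha_max] := @poly_ivt _ (p R k) _ _ x4.
  by rewrite Px ltW// p_gt0_4.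
by rewrite leNgt (lt_le_trans ax xz).
Qed.

Lemma alpha1 : alpha 1 = 1.
Proof.
have a1 : 1 <= alpha 1 by apply: alpha_max; rewrite horner_p1; ring.
have /eqP := horner_p_alpha 1; rewrite horner_p1 mulf_eq0 subr_eq0.
by move=> /orP[|] /eqP //; lra.
Qed.

Lemma alpha_ltS k : alpha k < alpha k.+1.
Proof.
suff [] : 0 <= alpha k /\ alpha k < alpha k.+1 by [].
elim: k => [|k [a0 IH]].
  by have := horner_p_alpha 0; rewrite horner_p0 => ->; rewrite alpha1.
have aS0 : 0 < alpha k.+1 by lra.
split; first exact: ltW.
(* At a root of [p k.+1] the recurrence leaves [- x * p k], and [p k] is already positive there. *)
have : P k.+2 (alpha k.+1) < 0.
  rewrite horner_pSS horner_p_alpha sub0r mulrN oppr_lt0 mulr_gt0//.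
  exact: p_gt0_gt_alpha.
apply: contraTT; rewrite -!leNgt le_eqVlt.
move=> /orP[/eqP <-|/p_gt0_gt_alpha/ltW//].
by rewrite horner_p_alpha.
Qed.

Lemma alpha_le : {homo alpha : i j / (i <= j)%N >-> i <= j}.
Proof.
apply: homo_leq => // [? ? ?|?]; [exact: le_trans|exact/ltW/alpha_ltS].
Qed.

Lemma alphaS_ge1 k : 1 <= alpha k.+1.
Proof. by rewrite -alpha1 alpha_le. Qed.

Lemma p_ge0_ge_alpha k x : alpha k <= x -> 0 <= P k x.
Proof.
rewrite le_eqVlt => /orP[/eqP<-|/p_gt0_gt_alpha/ltW//].
by rewrite horner_p_alpha.
Qed.

Lemma p_nonneg_ge_alpha k x : alpha k <= x -> p_nonneg k x.
Proof. by move=> ax j jk; rewrite p_ge0_ge_alpha// (le_trans _ ax)// alpha_le. Qed.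

Lemma alpha_le_p_nonneg k x : 0 < x -> p_nonneg k x -> alpha k <= x.
Proof.
move=> x0 nn; rewrite leNgt; apply/negP => xa.
by have := p_lt x0 xa nn; rewrite horner_p_alpha ltNge nn.
Qed.

Lemma alpha_le4 k : alpha k <= 4.
Proof. by rewrite alpha_le_p_nonneg//; exact: p_nonneg_4. Qed.

(** * Cassini's identity and the upper bound by a power of two *)

Lemma p_cassini k x : P k.+1 x ^+ 2 - P k.+2 x * P k x = x ^+ k.+2.
Proof.
elim: k => [|k IH]; first by rewrite horner_pSS horner_p1 horner_p0; ring.
by rewrite [x ^+ k.+3]exprS -IH (horner_pSS k.+1) !horner_pSS; ring.
Qed.

Lemma p_alphaSS k : P k.+1 (alpha k.+2) = P k (alpha k.+2).
Proof.
have := horner_p_alpha k.+2; rewrite horner_pSS => /eqP.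
have := alphaS_ge1 k.+1 => a1.
by rewrite mulf_eq0 subr_eq0 => /orP[/eqP|/eqP//]; lra.
Qed.

Lemma sqr_p_alphaS k : P k (alpha k.+1) ^+ 2 = alpha k.+1 ^+ k.+1.
Proof.
case: k => [|k]; first by rewrite horner_p0 alpha1 !expr1n.
by rewrite -p_cassini horner_p_alpha mul0r subr0.
Qed.

Lemma p_alphaSS_le k : P k (alpha k.+2) <= 2 ^+ k.+2.
Proof.
rewrite -p_alphaSS -(@ler_pXn2r _ 2)// ?nnegrE ?exprn_ge0//; last first.
  by rewrite p_ge0_ge_alpha// alpha_le.
rewrite sqr_p_alphaS -exprM mulnC exprM lerXn2r// ?nnegrE ?exprn_ge0//.
- by rewrite (le_trans ler01)// alphaS_ge1.
- by rewrite (le_trans (alpha_le4 _))//; lra.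
Qed.

(** * Lower bounds on the roots and the lower bound by a power of two *)

Lemma p_lt0_alpha k x : P k x < 0 -> x < alpha k.
Proof. by apply: contraTT; rewrite -!leNgt; exact: p_ge0_ge_alpha. Qed.

(** At [x = 4 cos^2 t] the characteristic roots are [2 cos t] times [exp (+- i t)], so [p k] is a
    rescaled Chebyshev polynomial of the second kind. *)
Lemma horner_p_cos k (t : R) :
  P k (4 * cos t ^+ 2) * sin t = (2 * cos t) ^+ k.+1 * sin (k.+2%:R * t).
Proof.
suff [] : P k (4 * cos t ^+ 2) * sin t
    = (2 * cos t) ^+ k.+1 * sin (k.+2%:R * t) /\
  P k.+1 (4 * cos t ^+ 2) * sin t
    = (2 * cos t) ^+ k.+2 * sin (k.+3%:R * t) by [].
elim: k => [|k [IH IH1]].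
  rewrite horner_p0 horner_p1; split.
    by rewrite (_ : 2 * t = t *+ 2) ?sin_mulr2n; ring.
  rewrite (_ : 3 * t = t *+ 2 + t); last by ring.
  by rewrite sinD sin_mulr2n cos_mulr2n; ring.
split=> //; rewrite horner_pSS -[LHS]mulrA mulrBl IH IH1.
have -> : k.+4%:R * t = k.+3%:R * t + t by rewrite -natr1; ring.
have -> : k.+2%:R * t = k.+3%:R * t - t by rewrite -[k.+3%:R]natr1; ring.
by rewrite sinB sinD !exprS; ring.
Qed.

Lemma sin_le x : 0 <= x -> sin x <= x.
Proof.
move=> x0; have [|c _] := @MVT_segment _ sin cos 0 x x0.
  exact/continuous_subspaceT/continuous_sin.
by rewrite sin0 !subr0 => ->; rewrite ler_piMl// cos_le1.
Qed.

Lemma alpha_ge_pi k : 4 - 4 * (pi / k.+2%:R) ^+ 2 <= alpha k.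
Proof.
case: k => [|k].
  have := horner_p_alpha 0; rewrite horner_p0 => ->.
  have := pi_ge2 R; nra.
have := pi_gt0 R => pi0; set t : R := pi / _.
have k3 : (3 : R) <= k.+3%:R by rewrite ler_nat.
have t0 : 0 < t by rewrite divr_gt0.
have tpi : t < pi by rewrite ltr_pdivrMr// ltr_pMr//; lra.
have st : 0 < sin t by rewrite sin_gt0_pi// t0.
(* With [t = pi / (k + 3)] the factor [sin ((k + 3) t)] vanishes, so this point is a root. *)
have : 4 * cos t ^+ 2 <= alpha k.+1.
  apply: alpha_max; apply: (mulIf (lt0r_neq0 st)).
  by rewrite horner_p_cos /t mulrCA divff ?mulr1 ?sinpi ?mulr0 ?mul0r.
apply: le_trans; rewrite cos2sin2.
have := sin_le (ltW t0); nra.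
Qed.

Lemma bernoulli_le k x : 0 <= x <= 1 -> 1 - k%:R * x <= (1 - x) ^+ k.
Proof.
move=> /andP[x0 x1]; elim: k => [|k IH]; first by rewrite mul0r subr0.
rewrite exprS -natr1; have k0 : 0 <= k%:R * (x * x) by rewrite !mulr_ge0.
apply: (@le_trans _ _ ((1 - x) * (1 - k%:R * x))); first by nra.
by rewrite ler_wpM2l// subr_ge0.
Qed.

(** As [x <= 4], the quotient [4^k / x^(k+1)] does not decrease with [k]: one numerical check at [m]
    settles a whole block of exponents. *)
Lemma alpha_pow_ge_of_le m j k x : 0 < x -> x <= alpha j ->
  4 ^+ m <= x ^+ m.+1 -> (j <= k.+1)%N -> (k <= m)%N ->
  4 ^+ k <= alpha k.+1 ^+ k.+1.
Proof.
move=> x0 xa xm jk km.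
have x4 : x <= 4 := le_trans xa (alpha_le4 _).
apply: (@le_trans _ _ (x ^+ k.+1)); last first.
  have ax : x <= alpha k.+1 by rewrite (le_trans xa)// alpha_le.
  by rewrite lerXn2r// nnegrE ltW// (lt_le_trans x0).
rewrite -(ler_pM2r (exprn_gt0 (m - k) x0)) -exprD addSn subnKC//.
apply: le_trans xm; rewrite -[in leRHS](subnKC km) exprD.
by rewrite ler_wpM2l ?exprn_ge0// lerXn2r// nnegrE ltW.
Qed.

(* For large [k], [alpha k.+1 >= 4 cos^2 (pi / (k + 3)) >= 4 (1 - (4 / (k + 3))^2)]
   and Bernoulli's inequality suffice; this fails for small [k], where the bound
   is tight at [k = 0] and [k = 1]. *)
Lemma alpha_pow_ge_large k : (17 <= k)%N -> 4 ^+ k <= alpha k.+1 ^+ k.+1.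
Proof.
move=> k17; have k18 : (18 : R) <= k.+1%:R by rewrite ler_nat.
pose c : R := 16 / k.+3%:R ^+ 2.
have kE : k.+3%:R = k.+1%:R + 2 :> R by rewrite -addn2 natrD.
have d0 : 0 < k.+3%:R ^+ 2 :> R by rewrite exprn_gt0.
have c0 : 0 <= c by rewrite divr_ge0// ltW.
(* Bernoulli then gives [4 * (1 - c)^(k+1) >= 1]. The threshold 17 is the least [k] satisfying this
   inequality. *)
have kc : k.+1%:R * c <= 3 / 4.
  by rewrite /c mulrA ler_pdivrMr// kE; nra.
have c1 : c < 1 by nra.
apply: (@alpha_pow_ge_of_le k k.+1 _ (4 * (1 - c))) => //; first by lra.
  apply: le_trans (alpha_ge_pi _).
  have := pi_gt0 R; have := pihalf_lt2 R => pi4 pi0.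
  rewrite expr_div_n mulrBr mulr1 lerD2l lerN2 ler_pM2l// /c ler_pM2r ?invr_gt0//.
  by nra.
have := @bernoulli_le k.+1 c; rewrite c0 (ltW c1) => /(_ isT) bern.
rewrite exprMn exprS -mulrA mulrCA ler_peMr ?exprn_ge0//; lra.
Qed.

Lemma alpha_pow_ge_small k : (k <= 16)%N -> 4 ^+ k <= alpha k.+1 ^+ k.+1.
Proof.
(* Each bound comes from a point where the polynomial is negative or zero; the later ones serve the
   blocks 4-5, 6-8 and 9-16 of [k]. *)
have a3 : 13 / 5 <= alpha 3.
  by apply/ltW/p_lt0_alpha; rewrite !horner_pSS horner_p1 horner_p0; lra.
have a4 : 3 <= alpha 4.
  by apply: alpha_max; rewrite !horner_pSS horner_p1 horner_p0; lra.
have a5 : 16 / 5 <= alpha 5.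
  by apply/ltW/p_lt0_alpha; rewrite !horner_pSS horner_p1 horner_p0; lra.
have a7 : 7 / 2 <= alpha 7.
  by apply/ltW/p_lt0_alpha; rewrite !horner_pSS horner_p1 horner_p0; lra.
have a10 : 37 / 10 <= alpha 10.
  by apply/ltW/p_lt0_alpha; rewrite !horner_pSS horner_p1 horner_p0; lra.
have [k9 k16|k9 _] := leqP 9 k.
  by apply: (@alpha_pow_ge_of_le 16 10 _ (37 / 10)) => //; lra.
have [k6|k6] := leqP 6 k.
  by apply: (@alpha_pow_ge_of_le 9 7 _ (7 / 2)) => //; [lra|exact: ltnW].
have [k4|k4] := leqP 4 k.
  by apply: (@alpha_pow_ge_of_le 5 5 _ (16 / 5)) => //; lra.
case: k k4 {k9 k6} => [|[|[|[|//]]]] _.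
- by rewrite alpha1 expr1n.
- have a2 : 2 <= alpha 2.
    by apply: alpha_max; rewrite !horner_pSS horner_p1 horner_p0; lra.
  by apply: (@alpha_pow_ge_of_le 1 2 _ 2) => //; lra.
- by apply: (@alpha_pow_ge_of_le 2 3 _ (13 / 5)) => //; lra.
- by apply: (@alpha_pow_ge_of_le 3 4 _ 3) => //; lra.
Qed.

Lemma p_alphaS_ge k : 2 ^+ k <= P k (alpha k.+1).
Proof.
rewrite -(@ler_pXn2r _ 2)// ?nnegrE ?exprn_ge0//; last first.
  by rewrite p_ge0_ge_alpha// alpha_le.
rewrite sqr_p_alphaS -exprM mulnC exprM (_ : 2 ^+ 2 = 4); last by ring.
have [k17|k16] := leqP 17 k; first exact: alpha_pow_ge_large.
exact: alpha_pow_ge_small.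
Qed.

(** * Strategy parameters as values of the polynomials *)

Lemma sum_horner_p i x : \sum_(k < i.+2) P k x = x * P i x.
Proof.
elim: i => [|i IH].
  by rewrite big_ord_recr big_ord1/= horner_p0 horner_p1; ring.
by rewrite big_ord_recr/= IH horner_pSS; ring.
Qed.

Lemma params_ge1 rho n a i : 1 <= rho -> params rho n a -> (i <= n)%N ->
  1 <= a i.
Proof.
move=> rho1 [an a01 amono _ _]; elim: i => [|i IH] iN.
  by case: n iN an a01 {amono} => [_ -> //|n _ _]; apply.
by rewrite (le_trans (IH (ltnW iN)))// amono.
Qed.

Lemma params_sum rho n a i : 1 <= rho -> params rho n a -> (i < n)%N ->
  \sum_(k < i.+2) a k = a 0%N * a i.
Proof.
move=> rho1 par iN; have ai0 : a i != 0.
  by rewrite lt0r_neq0// (lt_le_trans ltr01)// (params_ge1 rho1 par)// ltnW.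
case: par => an _ _ eq_lt eq_last; suff <- : (\sum_(k < i.+2) a k) / a i = a 0%N.
  by rewrite divfK.
move: iN; rewrite leq_eqVlt => /orP[/eqP iN|iN]; last first.
  by rewrite mulr_suml; have := eq_lt _ iN; lra.
(* Since [rho = a n], the last equation has the same form as the others, with [i = n - 1]. *)
subst n; rewrite big_ord_recr/= mulrDl mulr_suml an.
by have := eq_last isT; rewrite /= -mulrA; lra.
Qed.

Lemma params_horner rho n a i : 1 <= rho -> params rho n a -> (i <= n)%N ->
  a i = P i (a 0%N).
Proof.
move=> rho1 par; have sumE := params_sum rho1 par.
suff: ((i <= n)%N -> a i = P i (a 0%N)) /\
      ((i.+1 <= n)%N -> a i.+1 = P i.+1 (a 0%N)) by case.
elim: i => [|i [IH IH1]].
  split=> [_|n0]; first by rewrite horner_p0.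
  by have := sumE _ n0; rewrite big_ord_recr big_ord1/= horner_p1; lra.
(* Subtracting two consecutive sums yields the recurrence of the polynomials. *)
split=> // iN; rewrite horner_pSS -IH1 1?ltnW// -IH 1?ltnW 1?ltnW//.
have := sumE _ iN; rewrite big_ord_recr/= (sumE _ (ltnW iN)); lra.
Qed.

(** The index reaches [n + 1] because [p n.+1] at [a 0] is [a 0 * (a n - a n.-1)] for [n > 0],
    nonnegative by the last link of the chain. *)
Lemma params_p_nonneg rho n a : 1 <= rho -> params rho n a ->
  p_nonneg n.+1 (a 0%N).
Proof.
move=> rho1 par; have a0 := params_ge1 rho1 par (leq0n n).
case=> [_|[_|j]]; rewrite ?horner_p0 ?horner_p1 ?mulr_ge0//; try lra.
rewrite ltnS => jn; rewrite horner_pSS -!(params_horner rho1 par)// 1?ltnW//.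
by rewrite mulr_ge0// ?subr_ge0; [lra|case: par => _ _ + _ _; apply].
Qed.

Lemma params_alpha_le rho n a : 1 <= rho -> params rho n a ->
  alpha n.+1 <= a 0%N.
Proof.
move=> rho1 par; apply: alpha_le_p_nonneg (params_p_nonneg rho1 par).
by rewrite (lt_le_trans ltr01)// (params_ge1 rho1 par).
Qed.

Lemma horner_p_le x n i j : alpha n.+1 <= x -> (i <= j <= n)%N ->
  P i x <= P j x.
Proof.
move=> ax /andP[ij jn]; have x0 : 0 < x.
  by rewrite (lt_le_trans ltr01)// (le_trans (alphaS_ge1 n)).
elim: j ij jn => [|j IH]; first by rewrite leqn0 => /eqP->.
rewrite leq_eqVlt => /orP[/eqP->//|ij jn].
rewrite (le_trans (IH ij (ltnW jn)))// -subr_ge0 -(pmulr_rge0 _ x0) -horner_pSS.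
by apply: (p_nonneg_ge_alpha ax).
Qed.

(** Converse of [params_horner]: the equations are the telescoped recurrence, and the chain is
    [horner_p_le]. *)
Lemma params_of_horner x n : alpha n.+1 <= x ->
  params (P n x) n (fun i => P i x).
Proof.
move=> ax; have x1 := le_trans (alphaS_ge1 n) ax.
have P0 i : (i <= n)%N -> P i x != 0.
  move=> iN; have := @horner_p_le x n 0 i ax; rewrite leq0n iN horner_p0.
  by move=> /(_ isT) Pi; rewrite lt0r_neq0//; lra.
split=> //; rewrite ?horner_p0//.
- by move=> i iN; apply: (horner_p_le ax); rewrite leqnSn.
- move=> i iN; rewrite -mulr_suml sum_horner_p mulfK ?P0 1?ltnW 1?ltnW//; ring.
- case: n {ax} P0 => // n P0 _; have := sum_horner_p n x.
  rewrite big_ord_recr/= -mulr_suml => /(congr1 (fun z => z / P n x)).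
  rewrite mulfK ?P0// mulrDl; lra.
Qed.

(* [CR] of the [n]-th strategy is [2 * a 0 + 1], so optimality means that [a 0]
   is least: with fewer rounds [p m (b 0) = p n (a 0)] forces [a 0 <= b 0] by
   monotonicity, with more rounds [b 0] exceeds [alpha n.+2]. *)
Lemma params_a0_le rho n m a b : 1 <= rho -> params rho n a -> params rho m b ->
  rho < P n (alpha n.+2) -> a 0%N < alpha n.+2 /\ a 0%N <= b 0%N.
Proof.
move=> rho1 pa pb rho_lt.
have a1 := params_ge1 rho1 pa (leq0n n); have b1 := params_ge1 rho1 pb (leq0n m).
have aa := params_alpha_le rho1 pa; have ab := params_alpha_le rho1 pb.
have an : P n (a 0%N) = rho by rewrite -(params_horner rho1 pa)//; case: pa.
have bm : P m (b 0%N) = rho by rewrite -(params_horner rho1 pb)//; case: pb.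
have a_lt : a 0%N < alpha n.+2.
  rewrite ltNge; apply/negP; rewrite le_eqVlt => /orP[/eqP E|lt].
    by move: rho_lt; rewrite E an ltxx.
  have nn : p_nonneg n (alpha n.+2).
    by apply/p_nonneg_ge_alpha/alpha_le; lia.
  have := p_lt (lt_le_trans ltr01 (alphaS_ge1 _)) lt nn.
  by rewrite an; lra.
split=> //; rewrite leNgt; apply/negP => ba.
have [mn|nm] := leqP m n; last first.
  have : alpha n.+2 <= alpha m.+1 by rewrite alpha_le.
  by lra.
have nn := p_nonnegS (params_p_nonneg rho1 pb).
have := p_lt (lt_le_trans ltr01 b1) ba nn.
have := horner_p_le aa (i := m) (j := n); rewrite mn leqnn => /(_ isT).
by rewrite an bm; lra.
Qed.

Lemma exists_params rho n : P n (alpha n.+1) <= rho -> rho < P n (alpha n.+2) ->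
  exists a, params rho n a.
Proof.
move=> rho_ge rho_lt.
have [|x /andP[ax _]] := @poly_ivt _ (p R n - rho%:P) _ _ (ltW (alpha_ltS n.+1)).
  by rewrite !hornerE subr_le0 subr_ge0 rho_ge ltW.
rewrite /root !hornerE subr_eq0 => /eqP <-.
by exists (fun i => P i x); exact: params_of_horner.
Qed.

End SearchPolynomials.

(** * Upper and lower evaluation of the competitive ratio *)

Section CompetitiveRatio.
Set Implicit Arguments.
Unset Strict Implicit.
Unset Printing Implicit Defensive.
Context {R : realType}.
Variables (lam Lam : R).
Hypotheses (lam_gt0 : 0 < lam) (lam_le_Lam : lam <= Lam).
Implicit Types (a : nat -> R) (i n : nat).

Local Notation rho := (Lam / lam).

Lemma rho_ge1 : 1 <= rho.
Proof. by rewrite ler_pdivlMr// mul1r. Qed.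

Lemma strategyE n a i : params rho n a -> (i <= n)%N ->
  strategy lam Lam n a i = a i * lam.
Proof.
move=> [an _ _ _ _] iN; rewrite /strategy ltn_neqAle iN andbT.
by case: eqP => //= ->; rewrite an divfK// lt0r_neq0.
Qed.

Lemma CR_strategy_le n a : params rho n a ->
  (CR lam Lam (strategy lam Lam n a) <= (2 * a 0%N + 1)%:E)%E.
Proof.
move=> par; apply: ge_ereal_sup => _ [D /= + <-]; rewrite in_itv/= => /andP[lD DL].
have D0 : 0 < D := lt_le_trans lam_gt0 lD.
have a1 := params_ge1 rho_ge1 par (leq0n n).
have reachn : D <= strategy lam Lam n a n by rewrite /strategy ltnn.
rewrite /phi; case: pselect => [reached|[]]; last by exists n.
rewrite -EFinM lee_fin ler_pdivrMr// [(_ + 1) * D]mulrDl mul1r lerD2r -mulrA ler_pM2l//.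
case: ex_minnP => j _ jmin; have := jmin n reachn => jn.
have -> : \sum_(i < j.+1) strategy lam Lam n a i = (\sum_(i < j.+1) a i) * lam.
  rewrite mulr_suml; apply: eq_bigr => -[i /= ij] _.
  by rewrite strategyE// (leq_trans _ jn).
(* It remains to bound the sum by [a 0 * D]: in round 0 by [lam <= D], later because the preceding
   round fell short of [D]. *)
case: j jmin jn => [|j] jmin jn; first by rewrite big_ord1 ler_pM2l//; lra.
rewrite (params_sum rho_ge1 par)// -mulrA ler_pM2l; last lra.
rewrite -(strategyE par) 1?ltnW// ltW// ltNge; apply/negP => /jmin.
by rewrite ltnn.
Qed.

Lemma CR_strategy_ge n a : params rho n a ->
  ((2 * a 0%N + 1)%:E <= CR lam Lam (strategy lam Lam n a))%E.
Proof.
(* A target at distance [lam] is reached in round 0, at cost [2 * a 0 * lam + lam]. *)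
move=> par; apply: ereal_sup_ubound; exists lam => /=.
  by rewrite in_itv/= lexx.
have a1 := params_ge1 rho_ge1 par (leq0n n).
have f0 : lam <= strategy lam Lam n a 0 by rewrite strategyE// ler_peMl// ltW.
rewrite /phi; case: pselect => [reached|[]]; last by exists 0%N.
case: ex_minnP => j _ /(_ _ f0); rewrite leqn0 => /eqP->.
rewrite -EFinM big_ord1 strategyE//; congr (_%:E).
by field; rewrite lt0r_neq0.
Qed.

End CompetitiveRatio.

Theorem theorem4 (R : realType) (lam Lam : R)
    (lam_gt0 : 0 < lam) (lam_le_Lam : lam <= Lam) :
  let rho := Lam / lam in
  (forall n : nat,
     (p R n).[alpha R n.+1] <= rho -> rho < (p R n).[alpha R n.+2] ->
     (exists a : nat -> R, params rho n a) /\
     (forall a : nat -> R, params rho n a ->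
        optimal lam Lam n a /\
        (alpha R n.+1 <= a 0%N /\ a 0%N < alpha R n.+2)))
  /\
  (forall n : nat,
     (p R n).[alpha R n.+1] <= rho -> rho < (p R n).[alpha R n.+2] ->
     [/\ (2 : R) ^+ n <= (p R n).[alpha R n.+1],
         (p R n).[alpha R n.+1] <= rho,
         rho < (p R n).[alpha R n.+2]
       & (p R n).[alpha R n.+2] <= (2 : R) ^+ n.+2]).
Proof.
move=> rho; have rho1 : 1 <= rho := rho_ge1 lam_gt0 lam_le_Lam.
split=> n rho_ge rho_lt; last first.
  by split=> //; [exact: p_alphaS_ge|exact: p_alphaSS_le].
split=> [|a pa]; first exact: exists_params.
split; last first.
  by split; [exact: params_alpha_le pa|case: (params_a0_le rho1 pa pa rho_lt)].
move=> m b pb; apply: le_trans (CR_strategy_le lam_gt0 lam_le_Lam pa) _.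
apply: le_trans (CR_strategy_ge lam_gt0 lam_le_Lam pb).
have [_ ab] := params_a0_le rho1 pa pb rho_lt.
by rewrite lee_fin lerD2r ler_pM2l.
Qed.
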